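(* Let $F$ be a finite field of prime order $q$, $n\ge 1$, let $\mathcal{C}\subseteq M_n(F)$ be a similarity class with minimal polynomial $\mu$, and let $S$ be a nonempty subset of $\mathcal{C}$. Let $m\in F[x]$ be a monic irreducible polynomial of degree $s\ge 2$ with $m\mid\mu$, let $K$ be the splitting field of $m$ over $F$, let $\alpha_1,\dots,\alpha_s\in K$ be the roots of $m$, and put $f_{\alpha_i}=\mu/(x-\alpha_i)\in K[x]$. Then $$\bigcap_{A\in S}\mathcal{B}_F\Big(A,\frac{\mu}{m}\Big)=\{0\}\iff \forall\,1\le i\le s,\ \bigcap_{A\in S}\mathcal{B}_K(A,f_{\alpha_i})=\{0\}.$$
   Context: A similarity class is an orbit of $M_n(F)$ under conjugation by $\mathrm{GL}(n,F)$; $\mu\in F[x]$ is the common minimal polynomial of its elements. For a field $L$, in $M_n(L)[x]$ the indeterminate $x$ commutes with all coefficients, $L[x]\subseteq M_n(L)[x]$ via scalar matrices, and evaluation is with $x$ to the right of the coefficients: for $f=\sum_k B_kx^k$ and $A\in M_n(L)$, $f(A)=\sum_k B_kA^k$. For $A\in M_n(L)$ with minimal polynomial $m_A$ and $g\in L[x]$ with $g\mid m_A$, $\mathcal{B}_L(A,g)=\{f\in M_n(L)[x] : (fg)(A)=0,\ \deg f<\deg m_A-\deg g\}$ (the zero polynomial is always included, with $\deg 0=-\infty$). Matrices in $M_n(F)$ are regarded as elements of $M_n(K)$ when $L=K$. *)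

(* Defs.v *)
From HB Require Import structures.
From mathcomp Require Import all_boot all_order all_fingroup all_algebra all_field.
Set Implicit Arguments.
Unset Strict Implicit.
Unset Printing Implicit Defensive.
Import GRing.Theory.
Local Open Scope ring_scope.

Definition similarity_class (F : finFieldType) (n : nat) (A : 'M[F]_n.+1) :
    {set 'M[F]_n.+1} :=
  [set P *m A *m invmx P | P : 'M[F]_n.+1 in unitmx].

Definition is_similarity_class (F : finFieldType) (n : nat)
    (C : {set 'M[F]_n.+1}) : Prop :=
  exists A, C = similarity_class A.

(* [horner] keeps the coefficients to the left of the powers of the evaluation *)
(* point, [p.[A] = \sum_k p`_k * A ^+ k], also over a noncommutative ring.     *)
(* The degree bound [deg f < deg m_A - deg g], with [deg 0 = -oo], reads       *)
(* [size f <= deg m_A - deg g].  The definition is meant for [g] dividing      *)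
(* [mxminpoly A] (the minimal polynomial, hence nonzero), so the subtraction   *)
(* does not truncate.                                                          *)
Definition calB (L : fieldType) (n : nat) (A : 'M[L]_n.+1) (g : {poly L}) :
    {pred {poly 'M[L]_n.+1}} :=
  [pred f : {poly 'M[L]_n.+1} |
    ((f * map_poly (@scalar_mx L n.+1) g).[A] == 0) &&
    (size f <= (size (mxminpoly A)).-1 - (size g).-1)%N].

(* Main.v *)
(** Fix a root [a] of [m], and put [g = mu / m] and [h = m / (x - a)], so that
    [mu / (x - a) = h g].  A nonzero [f] over [F] with [f(A) g(A) = 0] yields the
    constant [f(a)]: since [A] acts on the range of [(h g)(A)] as the scalar [a],
    [f(a) (h g)(A) = f(A) (h g)(A) = 0], and [f(a) <> 0] because [m] is
    irreducible and [deg f < deg m].  Conversely, if [B <> 0] over [K] satisfies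
    [B (h g)(A) = 0], choose an [F]-linear form [phi] on [K] not vanishing at an
    entry of [B].  Applying [phi] to all entries of the coefficients of [B h]
    gives [f] over [F] of degree [deg m - 1], with leading coefficient
    [phi B <> 0]; as [A] and [g] are defined over [F],
    [f(A) g(A) = phi (B h(A) g(A)) = 0]. *)

Require Import Defs.
From HB Require Import structures.
From mathcomp Require Import all_boot all_order all_fingroup all_algebra all_field.
Set Implicit Arguments.
Unset Strict Implicit.
Unset Printing Implicit Defensive.
Import GRing.Theory.
Local Open Scope ring_scope.

Section MatrixPolynomials.

Variables (L : fieldType) (n : nat).
Implicit Types (A X : 'M[L]_n.+1) (f : {poly 'M[L]_n.+1}) (g h : {poly L}).

Lemma horner_mul_scalar_poly A f g :
  (f * map_poly (@scalar_mx L n.+1) g).[A] = f.[A] * horner_mx A g.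
Proof. by rewrite hornerM_comm //; apply: comm_mx_horner. Qed.

(** The columns of [X] are killed by [A - c], so [A ^+ k * X = c ^+ k *: X] in each term. The
    coefficients of [f] stay on the left and are untouched. *)
Lemma horner_mx_eigen A X (c : L) f :
  A * X = c *: X -> f.[A] * X = f.[c%:M] * X.
Proof.
move=> AX; rewrite !horner_coef !mulr_suml; apply: eq_bigr => k _.
rewrite -!mulrA; congr (_ * _).
elim: (nat_of_ord k) => [|j IHj]; first by rewrite !expr0.
rewrite exprSr exprS -!mulrA AX -IHj.
by rewrite -scalerAr -[c%:M * _]/(c%:M *m _) mul_scalar_mx.
Qed.

Lemma in_calB A g h f : mxminpoly A = g * h ->
  (f \in calB A g)
  = (f.[A] * horner_mx A g == 0) && (size f <= (size h).-1)%N.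
Proof.
move=> mA; rewrite inE /= horner_mul_scalar_poly; congr (_ && (_ <= _)%N).
have : g * h != 0 by rewrite -mA monic_neq0 ?mxminpoly_monic.
rewrite mulf_eq0 negb_or mA => /andP[g0 h0]; rewrite size_mul //.
rewrite -(prednK (n := size g)) ?size_poly_gt0 //.
by rewrite -(prednK (n := size h)) ?size_poly_gt0 //= addnS /= addKn.
Qed.

End MatrixPolynomials.

Section Extension.

Variables (F : fieldType) (K : fieldExtType F) (n : nat).

Lemma linear_form_neq0 (x : K) : x != 0 -> exists phi : {scalar K}, phi x != 0.
Proof.
move=> x0; have [|xP] := boolP [exists l, coord (vbasis {:K}) l x != 0].
  by case/existsP=> l; exists (coord (vbasis {:K}) l).
case/eqP: x0; rewrite (coord_vbasis (memvf x)) big1 // => l _.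
by move: xP => /existsPn/(_ l)/negbNE/eqP->; rewrite scale0r.
Qed.

(** [phi] is only [F]-linear, so it passes through a product exactly because the right factor has
    entries in [F]. *)
Lemma map_mx_linear_mulr (phi : {scalar K}) (M : 'M[K]_n) (N : 'M[F]_n) :
  map_mx phi (M *m map_mx (in_alg K) N) = map_mx phi M *m N.
Proof.
apply/matrixP=> i j; rewrite !mxE linear_sum; apply: eq_bigr => k _.
by rewrite !mxE /= -scalerAr mulr1 linearZ /= mulrC.
Qed.

(** [p] and [m] are coprime over [F], hence over [K], and share no root there. *)
Lemma root_irreducible_neq0 (m p : {poly F}) (a : K) :
    irreducible_poly m -> root (map_poly (in_alg K) m) a ->
    p != 0 -> (size p < size m)%N ->
  (map_poly (in_alg K) p).[a] != 0.
Proof.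
move=> m_irr ma p0 ltpm; apply: coprimep_root ma.
rewrite coprimep_map irreducible_poly_coprime //.
by apply: contraL ltpm => /(dvdp_leq p0); rewrite -leqNgt.
Qed.

End Extension.

Section Transfer.

Variables (F : fieldType) (K : fieldExtType F) (n : nat).
Local Notation iota := (in_alg K).
Variables (g m : {poly F}) (h : {poly K}) (a : K).
Hypothesis m_irr : irreducible_poly m.
Hypothesis m_monic : m \is monic.
Hypothesis mE : map_poly iota m = h * ('X - a%:P).

(** Choose a position where the leading coefficient of [f] is nonzero. The entries of [f] there form
    a nonzero polynomial over [F] of degree below that of [m], which cannot vanish at [a]. *)
Lemma horner_at_root_neq0 (f : {poly 'M[F]_n.+1}) :
  f != 0 -> (size f <= (size m).-1)%N -> (map_poly (map_mx iota) f).[a%:M] != 0.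
Proof.
move=> f0 fm; have [i [j pij]] :
    exists i j, \poly_(k < size f) (f`_k i j) != 0.
  have: lead_coef f != 0 by rewrite lead_coef_eq0.
  rewrite lead_coefE => /matrix0Pn[i [j fij]]; exists i, j.
  apply/eqP=> /(congr1 (fun p : {poly F} => p`_(size f).-1)).
  rewrite coef_poly coef0 prednK ?size_poly_gt0 // leqnn.
  exact/eqP.
apply/matrix0Pn; exists i, j.
suff -> : (map_poly (map_mx iota) f).[a%:M] i j
          = (map_poly iota (\poly_(k < size f) (f`_k i j))).[a].
  apply: (root_irreducible_neq0 m_irr _ pij).
    by rewrite mE rootM root_XsubC eqxx orbT.
  rewrite (leq_ltn_trans (size_poly _ _)) // (leq_ltn_trans fm) //.
  by rewrite prednK // size_poly_gt0 monic_neq0.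
rewrite (horner_coef_wide (n := size f)) ?size_poly //.
rewrite (horner_coef_wide (n := size f)); last first.
  by rewrite size_map_poly size_poly.
rewrite summxE; apply: eq_bigr => k _.
rewrite !coef_map coef_poly ltn_ord /=.
by rewrite -rmorphXn /= -[_ * _%:M]/(_ *m _) mul_mx_scalar !mxE /= mulrC.
Qed.

Lemma annihilator_ascent (A : 'M[F]_n.+1) (f : {poly 'M[F]_n.+1}) :
    horner_mx A (g * m) = 0 -> f.[A] * horner_mx A g = 0 ->
  (map_poly (map_mx iota) f).[a%:M]
    * horner_mx (map_mx iota A) (map_poly iota g * h) = 0.
Proof.
move=> muA0 fA0; set A' := map_mx iota A.
rewrite -(@horner_mx_eigen _ _ A').
  rewrite rmorphM /= mulrA -map_horner_mx horner_map.
  by rewrite -[_ * map_mx _ _]map_mxM [_ *m _]fA0 map_mx0 mul0r.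
(* The eigenvector condition remains: [(A' - a) * (g h)(A') = (g m)(A') = 0]. *)
apply/eqP; rewrite -subr_eq0 -mul_scalar_mx -[_ *m _]/(_ * _) -mulrBl.
rewrite -{1}(horner_mx_X A') -(horner_mx_C A') -rmorphB -rmorphM /=.
rewrite mulrC -mulrA -mE -rmorphM /= -map_horner_mx.
by rewrite muA0 map_mx0.
Qed.

(** This is [phi] applied entrywise to the coefficients of [B h]. As [h] is monic, the top one is
    [map_mx phi B]. *)
Definition form_poly (phi : {scalar K}) (B : 'M[K]_n.+1) : {poly 'M[F]_n.+1} :=
  \poly_(k < size h) map_mx phi (h`_k *: B).

Lemma form_poly_neq0 (phi : {scalar K}) (B : 'M[K]_n.+1) :
  map_mx phi B != 0 -> form_poly phi B != 0.
Proof.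
have h_monic : h \is monic.
  by rewrite -(monicMr _ (monicXsubC a)) -mE monic_map.
apply: contraNneq => /(congr1 (fun p : {poly _} => p`_(size h).-1)) /eqP.
rewrite coef_poly coef0 prednK ?size_poly_gt0 ?monic_neq0 // leqnn.
by rewrite -lead_coefE (monicP h_monic) scale1r.
Qed.

Lemma size_form_poly (phi : {scalar K}) (B : 'M[K]_n.+1) :
  (size (form_poly phi B) <= (size m).-1)%N.
Proof.
rewrite (leq_trans (size_poly _ _)) // -(size_map_poly iota) mE.
have [->|h0] := eqVneq h 0; first by rewrite size_poly0.
by rewrite size_Mmonic ?monicXsubC // size_XsubC addn2.
Qed.

Lemma annihilator_descent (phi : {scalar K}) (A : 'M[F]_n.+1) (B : 'M[K]_n.+1) :
    B * horner_mx (map_mx iota A) (map_poly iota g * h) = 0 ->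
  (form_poly phi B).[A] * horner_mx A g = 0.
Proof.
move=> B0; suff -> : (form_poly phi B).[A]
    = map_mx phi (B *m horner_mx (map_mx iota A) h).
  rewrite -[_ * _]map_mx_linear_mulr map_horner_mx -mulmxA.
  by rewrite -[X in B *m X]rmorphM /= mulrC [_ *m _]B0 map_mx0.
rewrite (horner_coef_wide (n := size h)) ?size_poly //.
rewrite [horner_mx _ h](horner_coef_wide (n := size h)) ?size_map_poly //.
rewrite -[_ *m _]/(_ * _) mulr_sumr raddf_sum; apply: eq_bigr => k _.
rewrite coef_poly ltn_ord coef_map /= -rmorphXn mulrA /=.
by rewrite -[B * _]/(B *m _) mul_mx_scalar -[RHS]/(map_mx phi (_ *m _)) map_mx_linear_mulr.
Qed.

End Transfer.

Theorem theorem5p3 (F : finFieldType) (hF : prime #|F|) (n : nat)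
  (C : {set 'M[F]_n.+1}) (hC : is_similarity_class C)
  (mu : {poly F}) (hmu : forall A, A \in C -> mxminpoly A = mu)
  (S : {set 'M[F]_n.+1}) (hS0 : S != set0) (hSC : S \subset C)
  (m : {poly F}) (s : nat)
  (hm_monic : m \is monic) (hm_irr : irreducible_poly m)
  (hm_deg : (size m).-1 = s) (hs : (2 <= s)%N) (hm_mu : m %| mu)
  (K : fieldExtType F)
  (hK : splittingFieldFor 1 (map_poly (in_alg K) m) {:K})
  (alpha : 'I_s -> K)
  (halpha : map_poly (in_alg K) m = \prod_(i < s) ('X - (alpha i)%:P)) :
  [pred f | [forall A in S, f \in calB A (mu %/ m)]] =i pred1 0
  <->
  forall i : 'I_s,
    [pred f | [forall A in S,
       f \in calB (map_mx (in_alg K) A)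
                  (map_poly (in_alg K) mu %/ ('X - (alpha i)%:P))]]
    =i pred1 0.
Proof.
pose g := mu %/ m.
pose h i := map_poly (in_alg K) m %/ ('X - (alpha i)%:P).
have mE i : map_poly (in_alg K) m = h i * ('X - (alpha i)%:P).
  by rewrite divpK // dvdp_XsubCl halpha (bigD1 i) //= rootM root_XsubC eqxx.
have muE : mu = g * m by rewrite divpK.
have muKE i : map_poly (in_alg K) mu
    = map_poly (in_alg K) g * h i * ('X - (alpha i)%:P).
  by rewrite -mulrA -mE -rmorphM -muE.
have gE i : map_poly (in_alg K) mu %/ ('X - (alpha i)%:P)
    = map_poly (in_alg K) g * h i.
  by rewrite (muKE i) mulpK // polyXsubC_eq0.
have minA A : A \in S -> mxminpoly A = g * m.
  by move=> AS; rewrite -muE hmu // (subsetP hSC).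
have calBF A f : A \in S -> (f \in calB A (mu %/ m))
    = (f.[A] * horner_mx A g == 0) && (size f <= (size m).-1)%N.
  by move=> AS; apply: in_calB; apply: minA.
have calBK i A f : A \in S ->
    (f \in calB (map_mx (in_alg K) A)
             (map_poly (in_alg K) mu %/ ('X - (alpha i)%:P)))
    = (f.[map_mx (in_alg K) A]
         * horner_mx (map_mx (in_alg K) A) (map_poly (in_alg K) g * h i) == 0)
      && (size f <= 1)%N.
  (* The cofactor is now linear, so the members over [K] are constants. The minimal polynomial is
     unchanged by the extension to [K]. *)
  move=> AS; rewrite gE (@in_calB _ _ _ _ ('X - (alpha i)%:P)).
    by rewrite size_XsubC.
  by rewrite mxminpoly_map minA // -muE (muKE i).
have [A0 A0S] := set0Pn _ hS0.
split=> [trivF i f | trivK f].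
  apply/idP/idP; last first.
    rewrite inE => /eqP->; apply/forall_inP=> A AS.
    by rewrite calBK // horner0 mul0r eqxx size_poly0.
  move=> /forall_inP fB; have := fB _ A0S; rewrite calBK // => /andP[_].
  move=> /size1_polyC fE; move: fB; rewrite {}fE; set B := f`_0 => fB.
  rewrite inE polyC_eq0; apply: contraT => /matrix0Pn[j [l Bjl]].
  (* [phi] is chosen from [B] alone, so the same [form_poly phi B] serves every [A] in [S]. *)
  have [phi phiB] := linear_form_neq0 Bjl.
  have: map_mx phi B != 0 by apply/matrix0Pn; exists j, l; rewrite mxE.
  move=> /(form_poly_neq0 hm_monic (mE i)); rewrite -[_ == 0]/(_ \in pred1 0).
  rewrite -trivF => /negP[]; apply/forall_inP=> A AS.
  rewrite calBF // (size_form_poly (mE i)) andbT; apply/eqP.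
  apply: annihilator_descent; have := fB _ AS.
  by rewrite calBK // hornerC => /andP[/eqP].
apply/idP/idP; last first.
  rewrite inE => /eqP->; apply/forall_inP=> A AS.
  by rewrite calBF // horner0 mul0r eqxx size_poly0.
(* One root suffices here; index 0 exists since [s] is positive. *)
move=> /forall_inP fB; pose i := Ordinal (ltnW hs).
rewrite inE; apply: contraT => f0.
have := fB _ A0S; rewrite calBF // => /andP[_ fm].
have := horner_at_root_neq0 hm_irr hm_monic (mE i) f0 fm.
rewrite -polyC_eq0 -[_ == 0]/(_ \in pred1 0) -(trivK i) => /negP[].
apply/forall_inP=> A AS; rewrite calBK // size_polyC_leq1 andbT hornerC.
apply/eqP; apply: (annihilator_ascent (mE i)).
  by rewrite -(minA A) // mx_root_minpoly.
by have := fB _ AS; rewrite calBF // => /andP[/eqP].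
Qed.
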